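(* Let $\rho_i,\rho_{i+1}\in\mathbb{R}$ be two consecutive nudges (gain values). Suppose the same policy $\pi^*\in\Pi$ is optimal for both nudged problems, i.e. $$\pi^*\in\operatorname*{arg\,max}_{\pi\in\Pi}\left(v^\pi-\rho_i c^\pi\right)\quad\text{and}\quad \pi^*\in\operatorname*{arg\,max}_{\pi\in\Pi}\left(v^\pi-\rho_{i+1}c^\pi\right),$$ and that the optimal nudged value of the recurrent state changes sign between them, i.e. $v^{\pi^*}-\rho_i c^{\pi^*}$ and $v^{\pi^*}-\rho_{i+1}c^{\pi^*}$ have opposite signs. Then $\pi^*$ is gain-optimal: $\frac{v^{\pi^*}}{c^{\pi^*}}\ge\frac{v^\pi}{c^\pi}$ for all $\pi\in\Pi$.
   Context: A semi-Markov decision process has finite state and action sets; taking action $a$ in state $s$ yields a reward and an action cost. $\Pi$ is the (finite) set of deterministic stationary policies. The process is unichain (every policy has only one recurrent class) and $s_I$ is a fixed recurrent state (a state belonging to the recurrent class of every policy). For $\pi\in\Pi$, $v^\pi\in\mathbb{R}$ and $c^\pi$ are the expected total reward and expected total action cost accumulated under $\pi$ starting from $s_I$ until the first return to $s_I$ (the return to $s_I$ is regarded as reaching a terminal state); $c^\pi\ge1$ for all $\pi$. The gain (average reward per unit of cost) of $\pi$ is $v^\pi/c^\pi$, and a policy is gain-optimal if it maximizes the gain over $\Pi$. At least one policy is assumed to have positive gain. For a fixed number $\rho$ (a nudge), the nudged problem is the cumulative-reward problem with rewards (reward) $-\rho\,\cdot$ (cost); a policy $\pi$ has nudged value $v^\pi-\rho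 c^\pi$ at the recurrent state $s_I$, and is nudged-optimal if it maximizes this quantity over $\Pi$. *)

(* Defs.v *)
From mathcomp Require Import all_boot all_order all_algebra.
From mathcomp Require Import all_classical all_reals all_analysis.
Set Implicit Arguments.
Unset Strict Implicit.
Unset Printing Implicit Defensive.
Import Order.TTheory GRing.Theory Num.Theory.
Import numFieldNormedType.Exports.
Local Open Scope ring_scope.

(* Reward and cost of one decision epoch may depend on the state reached; they
   stand for their conditional means given (s, a, t).  The random sojourn time
   of a semi-Markov process, when it matters, is one instance of the cost.
   Actions may be unavailable in some states. *)
Record smdp (R : realType) (S A : finType) := SMDP {
  actions : S -> {set A};
  trans : S -> A -> S -> R;
  reward : S -> A -> S -> R;
  cost : S -> A -> S -> R;
  actions_neq0 : forall s, actions s != finset.set0;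
  trans_ge0 : forall s a t, a \in actions s -> 0 <= trans s a t;
  trans_sum1 : forall s a, a \in actions s -> \sum_t trans s a t = 1
}.

Section Smdp.
Context {R : realType} {S A : finType}.
Variable M : smdp R S A.
Implicit Types (pi : {ffun S -> A}) (s t : S) (w : seq S) (C : {set S}).

Definition policies : {set {ffun S -> A}} :=
  [set pi : {ffun S -> A} | [forall s, pi s \in actions M s]]%SET.

(* A trajectory [:: s; t_1; ...; t_n] is given by s and w = [:: t_1; ...; t_n]. *)
Definition traj_prob pi s w : R :=
  \prod_(x <- pairmap (fun u t => trans M u (pi u) t) s w) x.

Definition traj_reward pi s w : R :=
  \sum_(x <- pairmap (fun u t => reward M u (pi u) t) s w) x.

Definition traj_cost pi s w : R :=
  \sum_(x <- pairmap (fun u t => cost M u (pi u) t) s w) x.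

(* E_s[f ; T < oo] where T >= 1 is the first return time to s and f depends on
   the trajectory up to T: the term of index n is E_s[f ; T = n + 1], a sum
   over the trajectories s, w_1, ..., w_n, s whose w_i all differ from s.
   If s is accessible from every state, T has a geometric tail and the series
   converges absolutely for f of linear growth in T. *)
Definition cycle_expectation pi s (f : seq S -> R) : R :=
  limn (series (fun n => \sum_(w : n.-tuple S | s \notin (w : seq S))
    traj_prob pi s (rcons w s) * f (rcons w s))).

Definition return_prob pi s : R := cycle_expectation pi s (fun=> 1).

Definition recurrent pi s : Prop := return_prob pi s = 1.

Definition accessible pi : rel S :=
  connect (fun s t => 0 < trans M s (pi s) t).

Definition communicate pi : rel S :=
  fun s t => accessible pi s t && accessible pi t s.

Definition recurrent_class pi C : Prop :=
  exists2 s, recurrent pi s & C = [set t | communicate pi s t]%SET.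

Definition unichain : Prop :=
  forall pi, pi \in policies -> exists! C, recurrent_class pi C.

Definition recurrent_state s : Prop :=
  forall pi C, pi \in policies -> recurrent_class pi C -> s \in C.

Definition value sI pi : R := cycle_expectation pi sI (traj_reward pi sI).

Definition total_cost sI pi : R := cycle_expectation pi sI (traj_cost pi sI).

Definition gain sI pi : R := value sI pi / total_cost sI pi.

Definition gain_optimal sI pi : Prop :=
  pi \in policies /\ forall pi', pi' \in policies -> gain sI pi' <= gain sI pi.

(* Expected total of reward - rho * cost over a cycle, split by linearity. *)
Definition nudged_value sI (rho : R) pi : R :=
  value sI pi - rho * total_cost sI pi.

Definition nudged_optimal sI (rho : R) pi : Prop :=
  pi \in policies /\
  forall pi', pi' \in policies -> nudged_value sI rho pi' <= nudged_value sI rho pi.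

End Smdp.

Definition opposite_signs {R : realType} (x y : R) : Prop :=
  (0 < x /\ y < 0) \/ (x < 0 /\ 0 < y).

(* Main.v *)
(* A nudged value is affine in the nudge, so a policy that is optimal for two
   nudges is optimal for every nudge between them.  If its nudged value changes
   sign, one of these is its own gain [g], where its nudged value vanishes;
   optimality there reads [v - g * c <= 0], i.e. [v / c <= g], for all policies. *)

Require Import Defs.
From mathcomp Require Import all_boot all_order all_algebra.
From mathcomp Require Import all_classical all_reals all_analysis.
From mathcomp Require Import lra.
Set Implicit Arguments.
Unset Strict Implicit.
Unset Printing Implicit Defensive.
Import Order.TTheory GRing.Theory Num.Theory.
Import numFieldNormedType.Exports.
Local Open Scope ring_scope.

(** The nudge [v0 / c0] is the mean of [r1] and [r2] with weights proportional to [- (v0 - r2 * c0)]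
    and [v0 - r1 * c0], both positive. *)
Lemma le_ratio_of_sign_change (R : realFieldType) (r1 r2 v0 c0 v c : R) :
  0 < c0 -> 0 < c ->
  v - r1 * c <= v0 - r1 * c0 -> v - r2 * c <= v0 - r2 * c0 ->
  0 < v0 - r1 * c0 -> v0 - r2 * c0 < 0 ->
  v / c <= v0 / c0.
Proof.
move=> c0_gt0 c_gt0 le1 le2 x_gt0 y_lt0.
(* [(r2 - r1) * c0] is the drop from the positive to the negative nudged value. *)
have r12 : 0 < r2 - r1 by rewrite -(pmulr_lgt0 _ c0_gt0); lra.
rewrite ler_pdivrMr // mulrAC ler_pdivlMr // -(ler_pM2l r12).
(* Combined with these weights, the two right-hand sides cancel. *)
have := ler_wpM2l (ltW x_gt0) le2.
have ny_ge0 : 0 <= - (v0 - r2 * c0) by rewrite oppr_ge0 ltW.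
have := ler_wpM2l ny_ge0 le1.
(* The weighted left-hand sides add up to [(r2 - r1) * (v * c0 - v0 * c)]. *)
lra.
Qed.

Theorem lemma15 (R : realType) (S A : finType) (M : smdp R S A) (sI : S)
  (Huni : unichain M)
  (HsI : recurrent_state M sI)
  (Hcost : forall pi, pi \in policies M -> 1 <= total_cost M sI pi)
  (Hgain : exists2 pi, pi \in policies M & 0 < gain M sI pi)
  (rho : nat -> R) (i : nat) (pistar : {ffun S -> A})
  (Hi : nudged_optimal M sI (rho i) pistar)
  (Hi1 : nudged_optimal M sI (rho i.+1) pistar)
  (Hsign : opposite_signs (nudged_value M sI (rho i) pistar)
                          (nudged_value M sI (rho i.+1) pistar)) :
  gain_optimal M sI pistar.
Proof.
case: Hi Hi1 => star_pol opt1 [_ opt2]; split=> // pi pi_pol.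
have cost_gt0 p : p \in policies M -> 0 < total_cost M sI p.
  by move=> /Hcost; apply: lt_le_trans.
have := opt1 pi pi_pol; have := opt2 pi pi_pol.
case: Hsign => -[]; rewrite /nudged_value /gain => s1 s2 le2 le1.
- exact: (le_ratio_of_sign_change (cost_gt0 _ star_pol) (cost_gt0 _ pi_pol)
    le1 le2 s1 s2).
(* Here the value rises through zero, so the two nudges exchange roles. *)
- exact: (le_ratio_of_sign_change (cost_gt0 _ star_pol) (cost_gt0 _ pi_pol)
    le2 le1 s2 s1).
Qed.
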